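(* Let $F$ be an algebraically closed field of characteristic $0$ and let $l=4$ or $l=9$. Then for all integers $r$ and all integers $k\ge0$, $h(l,r;k)=c(l,r;k)$; equivalently $H_{l,r}=C_{l,r}$.
   Context: Let $S=F[x,y,z]=\bigoplus_kS^k$, $S^j=0$ for $j<0$. For points $p_1,\dots,p_l\in F^3\setminus\{0\}$, $h(\mathbf p;r;k)=\dim_F S^k/\sum_{i=1}^lS^{k-r}p_i^{r}$, and $h(l,r;k)$ is the minimum of this over all $\mathbf p$ (the value for $l$ generic points of $\mathbb P^2$, all with the same exponent $r$), with $h(l,r;k)=0$ if $r<0$. $c(l,r;k)=\operatorname{trunc}\bigl(\binom{k+2}{2}-l\binom{k-r+2}{2}\bigr)$ if $r\le k$ and $c(l,r;k)=\binom{k+2}{2}$ if $r>k$, where $\operatorname{trunc}(x)=x$ if $x>0$ and $0$ otherwise. $H_{l,r}(q)=\sum_k h(l,r;k)q^k$ and $C_{l,r}(q)=\sum_kc(l,r;k)q^k$. *)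

(* Defs.v *)
From HB Require Import structures.
From mathcomp Require Import all_boot all_order all_algebra.
From mathcomp Require Import mpoly.
Set Implicit Arguments. Unset Strict Implicit. Unset Printing Implicit Defensive.
Import Order.TTheory GRing.Theory Num.Theory.
Local Open Scope ring_scope.

(* S = F[x,y,z] is {mpoly F[3]}; a point p in F^3 is identified with the
   linear form p_0 x + p_1 y + p_2 z. *)
Definition linform (F : fieldType) (p : 'rV[F]_3) : {mpoly F[3]} :=
  \sum_(i < 3) p 0 i *: 'X_i.

Definition monos (k : nat) := 'X_{1..3 < k.+1}.

Definition coefrow (F : fieldType) (k : nat) (g : {mpoly F[3]})
  : 'rV[F]_#|{: monos k}| :=
  \row_(j < #|{: monos k}|) g@_(val (enum_val j)).

Definition dimSk (k : nat) : nat :=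
  #|[set m : monos k | mdeg (val m) == k]|.

(* Matrix whose rows are the coefficient vectors of the spanning family
   { m * p_i^r : i < l, m monomial of degree k - r } of
   \sum_i S^(k-r) p_i^r  (for r <= k); rows for monomials of degree < k-r
   are zero. *)
Definition genmx (F : fieldType) (l r k : nat) (p : 'I_l -> 'rV[F]_3) :=
  \matrix_(a < #|{: 'I_l * monos (k - r)%N}|, j < #|{: monos k}|)
    (let im := enum_val a in
     if mdeg (val im.2) == (k - r)%N
     then coefrow k ('X_[val im.2] * linform (p im.1) ^+ r) 0 j
     else 0).

(* h(p; r; k) = dim_F S^k / \sum_i S^(k-r) p_i^r, for r >= 0 *)
Definition hpts (F : fieldType) (l r k : nat) (p : 'I_l -> 'rV[F]_3) : nat :=
  if (k < r)%N then dimSk k else (dimSk k - \rank (genmx r k p))%N.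

Definition is_hmin (F : fieldType) (l r k : nat) (n : nat) : Prop :=
  (exists p : 'I_l -> 'rV[F]_3, (forall i, p i != 0) /\ hpts r k p = n) /\
  (forall p : 'I_l -> 'rV[F]_3, (forall i, p i != 0) -> (n <= hpts r k p)%N).

Definition is_h (F : fieldType) (l : nat) (r : int) (k : nat) (n : nat) : Prop :=
  if (r < 0)%R then n = 0%N else is_hmin F l `|r|%N k n.

(* c(l,r;k); truncated nat subtraction implements trunc *)
Definition cval (l : nat) (r : int) (k : nat) : nat :=
  if (r <= k%:Z)%R then ('C(k.+2, 2) - l * 'C(`|k%:Z - r|%N.+2, 2))%N
  else 'C(k.+2, 2).

(* Main.v *)
Require Import Defs.
From HB Require Import structures.
From mathcomp Require Import all_boot all_order all_algebra.
From mathcomp Require Import mpoly.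
From mathcomp Require Import zify ring.
Set Implicit Arguments.
Unset Strict Implicit.
Unset Printing Implicit Defensive.
Import Order.TTheory GRing.Theory Num.Theory.
Local Open Scope ring_scope.

(** Write l = d^2 with d = 2 or 3, and take the points (t, t^d, 1) for
    t = 0, ..., d^2 - 1, which lie on the conic or cuspidal cubic
    x^d = y z^(d-1).  By apolarity a linear form on S^k that kills every
    S^(k-r) p_i^r is a form of degree k with multiplicity m = k - r + 1 at each
    p_i.  In the affine coordinates (x, u) with u = x^d - y the curve is u = 0,
    and the form becomes f = sum_c f_c(x) u^c with f_c divisible by
    prod_i (x - t_i)^(m-c).  If f_0 = ... = f_(c-1) = 0, then f is u^c times a
    polynomial of degree at most k - dc in (x, y), so f_c has degree at most
    d(k - dc).  For d = 3 its coefficient of degree 3(k - 3c) - 1 also vanishes;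
    as sum_i t_i is nonzero, this excludes prod_i (x - t_i)^(m-c) itself when
    k = 3m and c < m.  The number of pairs (c, deg f_c) left is at most
    max(0, binom(k+2, 2) - l binom(m+1, 2)), and this bounds the dimension. *)

(** * Counting the possible degrees of the coefficients f_c *)

(* The possible degrees of f_c when f_0 = ... = f_(c-1) = 0; the missing value
   [hi.-1] when d = 3 reflects the cusp at infinity. *)
Definition positions (d k m c : nat) : seq nat :=
  let lo := (d ^ 2 * (m - c))%N in
  let hi := (d * (k - d * c))%N in
  if (k < d * c)%N then [::]
  else if d == 2%N then iota lo (hi.+1 - lo)
  else if (hi < lo)%N then [::]
  else if (hi == lo)%N then (if (c < m)%N then [::] else [:: hi])
  else hi :: iota lo (hi - lo).-1.

(** Dividing by u lowers the degree by d and each multiplicity by one. *)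
Lemma positionsS d k m c :
  (d <= k)%N -> positions d k m c.+1 = positions d (k - d) m.-1 c.
Proof.
move=> dk; rewrite /positions mulnS.
have -> : (k < d + d * c)%N = (k - d < d * c)%N by lia.
have -> : (m - c.+1 = m.-1 - c)%N by lia.
have -> : (c.+1 < m)%N = (c < m.-1)%N by lia.
by have -> : (k - (d + d * c) = k - d - d * c)%N by lia.
Qed.

Lemma positions_out d k m c : (k < d * c)%N -> positions d k m c = [::].
Proof. by rewrite /positions => ->. Qed.

Lemma double_bin2 n : ('C(n.+1, 2) * 2 = n.+1 * n)%N.
Proof. by rewrite mulnC -mul_bin_diag bin1. Qed.

(** Induction on [n]: the terms with c > 0 form the same sum for (k - d, m - 1). For k >= d and m >
    0 the term c = 0 has size max(0, 2k + 1 - 4m) or max(0, 3k - 9m), and what stands before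
    truncation is the difference of the two untruncated bounds. *)
Lemma sum_size_positions (d n k m : nat) : (d == 2%N) || (d == 3%N) ->
  (\sum_(c < n) size (positions d k m c) <= 'C(k.+2, 2) - d ^ 2 * 'C(m.+1, 2))%N.
Proof.
move=> hd; elim: n k m => [|n IHn] k m; first by rewrite big_ord0.
rewrite big_ord_recl /=.
have -> : (\sum_(i < n) size (positions d k m (lift ord0 i)) =
   if (d <= k)%N then \sum_(i < n) size (positions d (k - d) m.-1 i) else 0)%N.
  case: leqP => dk; first by apply: eq_bigr => i _; rewrite positionsS.
  by rewrite big1 // => i _; rewrite positions_out // lift0 mulnS ltn_addr.
have {}IHn := IHn (k - d)%N m.-1.
move: (\sum_(i < n) _)%N IHn => T.
have e1 := double_bin2 k.+1.
have e2 := double_bin2 m.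
have e3 := double_bin2 (k - d).+1.
have e4 := double_bin2 m.-1.
rewrite /positions /= subn0 muln0 subn0 ltn0.
move: ('C(k.+2, 2)) ('C(m.+1, 2)) ('C((k - d).+2, 2)) ('C(m.-1.+1, 2)) e1 e2 e3 e4.
move=> A B C D.
case/orP: hd => /eqP -> /=.
- rewrite size_iota; have [dk|dk] := leqP 2 k; last first.
    case: m => [|m] e1 e2 e3 e4 hT; last by lia.
    by case: k dk e1 e3 hT => [|[|k]] // _; lia.
  have [j ->] : exists j, k = (j + 2)%N by exists (k - 2)%N; lia.
  rewrite !addnK; case: m => [|m] /= e1 e2 e3 e4 hT; first by lia.
  (* This decides whether the inductive bound truncates to 0: with [m] now the predecessor, the
     products below are 2 binom(j+2, 2) and 8 binom(m+1, 2). *)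
  have [hj|hj] := ltnP j (2 * m).
    have : (j.+2 * j.+1 <= (2 * m.+1) * (2 * m))%N by apply: leq_mul; lia.
    lia.
  have : ((2 * m.+1) * (2 * m) <= j.+2 * j.+1)%N by apply: leq_mul; lia.
  lia.
- have [dk|dk] := leqP 3 k; last first.
    case: m => [|m] e1 e2 e3 e4 hT.
      by case: k dk e1 e3 hT => [|[|[|k]]] //= _; lia.
    by case: ltngtP => hk /=; lia.
  have [j ->] : exists j, k = (j + 3)%N by exists (k - 3)%N; lia.
  rewrite !addnK; case: m => [|m] /= e1 e2 e3 e4 hT.
    by rewrite muln0 muln_eq0 addn_eq0 /= andbF /= size_iota; lia.
  have [hj|hj] := ltnP j (3 * m).
    have : (j.+2 * j.+1 <= (3 * m.+1) * (3 * m))%N by apply: leq_mul; lia.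
    by case: ltngtP => hk /=; rewrite ?size_iota; lia.
  have : ((3 * m.+1) * (3 * m) <= j.+2 * j.+1)%N.
    have -> : (3 * m.+1 * (3 * m) = (3 * m) * (3 * m) + 9 * m)%N by lia.
    have := leq_mul hj hj; lia.
  by case: ltngtP => hk /=; rewrite ?size_iota; lia.
Qed.

(** * Total degree under the change of coordinates u = x^d - y *)

(* The substitution Y := x^d - Y is an involution: it passes both from
   (x, y) to (x, u) and back. *)
Definition curve (F : fieldType) (d : nat) : {poly {poly F}} := 'X^d%:P - 'X.

Lemma curve_compK (F : fieldType) d (g : {poly {poly F}}) :
  (g \Po curve F d) \Po curve F d = g.
Proof.
rewrite -comp_polyA /curve comp_polyB comp_polyC comp_polyX.
by rewrite opprB addrC subrK comp_polyXr.
Qed.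

(** The outer index is the power of y and the inner one that of x. The formula recovers the
    coefficients of [g] from those of the product by induction on [j]. *)
Lemma coef_curveM (F : fieldType) d (g : {poly {poly F}}) i j :
  (curve F d * g)`_j`_(i + d) = g`_j`_i - (if j is j'.+1 then g`_j'`_(i + d) else 0).
Proof.
rewrite mulrBl coefB coefB coefCM coefXnM ltnNge leq_addl /= addnK; congr (_ - _).
by rewrite coefXM; case: j => //=; rewrite coef0.
Qed.

Lemma tdeg_curveM (F : fieldType) d k (g : {poly {poly F}}) : (0 < d)%N ->
  (forall i j, (k < i + j)%N -> (curve F d * g)`_j`_i = 0) ->
  forall i j, (k < i + j + d)%N -> g`_j`_i = 0.
Proof.
move=> d0 hg i j; elim: j i => [|j IHj] i hk.
  by have := coef_curveM d g i 0; rewrite hg ?subr0; last by lia.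
have := coef_curveM d g i j.+1; rewrite hg; last by lia.
by rewrite IHj ?subr0; last by lia.
Qed.

Lemma tdeg_curveXM (F : fieldType) d k c (g : {poly {poly F}}) : (0 < d)%N ->
  (forall i j, (k < i + j)%N -> (curve F d ^+ c * g)`_j`_i = 0) ->
  forall i j, (k < i + j + d * c)%N -> g`_j`_i = 0.
Proof.
move=> d0; elim: c k => [|c IHc] k hg i j hk; first by have := hg i j; rewrite expr0 mul1r; apply; lia.
have [dk|kd] := leqP d k.
  apply: (IHc (k - d)%N); last by lia.
  move=> i' j' hk'; apply: tdeg_curveM (k) _ d0 _ _ _ _; last by lia.
  by move=> i1 j1 h1; rewrite mulrA -exprS hg.
(* Here k < d, so the degree bound kills every coefficient of u^c g, and u is nonzero because its
   coefficient at y is -1. *)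
suff -> : g = 0 by rewrite !coef0.
have : curve F d ^+ c * g = 0.
  apply/polyP => j1; apply/polyP => i1; rewrite !coef0.
  by apply: tdeg_curveM (k) _ d0 _ _ _ _; [move=> i2 j2 h1; rewrite mulrA -exprS hg|lia].
move/eqP; rewrite mulf_eq0 expf_eq0 => /orP[/andP[_ /eqP h0]|/eqP //].
have := congr1 (fun p : {poly {poly F}} => p`_1`_0) h0.
rewrite /curve coefB coefC coefX !coef0 sub0r coefN coef1 => /eqP.
by rewrite oppr_eq0 oner_eq0.
Qed.

(** The constant term in u is the restriction g(x, x^d) to the curve. *)
Lemma coef_comp_curve0 (F : fieldType) d (g : {poly {poly F}}) e :
  (g \Po curve F d)`_0`_e =
    \sum_(j < size g) (if (e < d * j)%N then 0 else g`_j`_(e - d * j)).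
Proof.
rewrite -horner_coef0 horner_comp /curve !hornerE horner_coef coef_sum.
apply: eq_bigr => j _; rewrite subr0 -exprM coefMXn mulnC; by rewrite mulnC.
Qed.

(** Put K = k - dc. A monomial x^i y^j with i + j <= K restricts to degree i + dj <= dK. For d = 3,
    j = K gives 3K and j < K gives at most 3K - 2, so 3K - 1 is missed. The condition K > 0 keeps
    the predecessor of 3K from being 0 itself. *)
Lemma coef_comp_curve0_eq0 (F : fieldType) (d k c : nat) (g : {poly {poly F}}) (e : nat) :
  (0 < d)%N ->
  (forall i j, (k < i + j + d * c)%N -> g`_j`_i = 0) ->
  (k < d * c)%N || (d * (k - d * c) < e)%N
    || [&& d == 3%N, (0 < k - d * c)%N & e == (d * (k - d * c)).-1] ->
  (g \Po curve F d)`_0`_e = 0.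
Proof.
move=> d0 hg he; rewrite coef_comp_curve0 big1 // => j _.
case: ltnP => // hj; apply: hg.
move: (nat_of_ord j) hj => {}j hj.
case/orP: he => [/orP[he|he]|/and3P[/eqP d3 hk /eqP he]]; last first.
- by subst d; lia.
- have [hjk|hjk] := leqP j (k - d * c); last by lia.
  have [x xE] : exists x, (k - d * c = j + x)%N by exists (k - d * c - j)%N; lia.
  move: he; rewrite xE mulnDr => he.
  have := leq_pmull x d0; lia.
- lia.
Qed.

(** * Forms forced to vanish by their multiplicities and degrees *)

Section Points.
Variable F : fieldType.
Hypothesis hF : [pchar F] =i pred0.

Lemma natr_inj_pchar0 : injective (fun n : nat => n%:R : F).
Proof.
move=> a b; wlog hab : a b / (a <= b)%N.
  by move=> H; case/orP: (leq_total a b) => h e; [|symmetry]; apply: H.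
move=> /= e; have /eqP : (b - a)%:R = 0 :> F by rewrite natrB // e subrr.
by rewrite ((pcharf0P F).1 hF); lia.
Qed.

(** One product of linear factors over the roots listed with multiplicity, the shape to which
    Vieta's formula applies. *)
Definition ptpoly (N n : nat) : {poly F} :=
  \prod_(x <- flatten (nseq n [seq (i : nat)%:R : F | i <- iota 0 N])) ('X - x%:P).

Lemma ptpolyE N n : ptpoly N n = \prod_(i <- iota 0 N) ('X - i%:R%:P) ^+ n.
Proof.
rewrite /ptpoly prodrXl; elim: n => [|n IHn]; first by rewrite big_nil expr0.
by rewrite /= big_cat /= IHn exprS big_map.
Qed.

(** In characteristic 0 the roots 0, ..., N - 1 are distinct, so the powers are pairwise coprime. *)
Lemma dvdp_ptpoly N n h :
  (forall i, (i < N)%N -> ('X - i%:R%:P) ^+ n %| h) -> ptpoly N n %| h.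
Proof.
rewrite ptpolyE; elim: N => [|N IHN] hh; first by rewrite big_nil dvd1p.
rewrite -addn1 iotaD big_cat /= big_seq1 add0n Gauss_dvdp.
  by rewrite hh // IHN // => i hi; apply: hh; lia.
rewrite coprimep_expr // big_seq_cond; elim/big_rec: _ => [|i p]; first exact: coprime1p.
rewrite andbT mem_iota => hi hp; rewrite coprimepMl hp andbT coprimep_expl //.
rewrite coprimep_XsubC2 // subr_eq0; apply/eqP => /natr_inj_pchar0; lia.
Qed.

Lemma size_ptpoly N n : size (ptpoly N n) = (N * n).+1.
Proof.
rewrite size_prod_XsubC; congr _.+1.
elim: n => [|n IHn] /=; first by rewrite muln0.
by rewrite size_cat IHn size_map size_iota mulnS.
Qed.

Lemma coef_ptpoly N n : (0 < N * n)%N ->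
  (ptpoly N n)`_(N * n).-1 = - (n * 'C(N, 2))%:R.
Proof.
move=> h0; have := size_ptpoly N n; rewrite size_prod_XsubC => -[hs].
rewrite -{1}hs coefPn_prod_XsubC ?hs -?lt0n //; congr (- _).
elim: n {h0 hs} => [|n IHn]; first by rewrite big_nil.
rewrite /= big_cat /= IHn mulSn natrD; congr (_ + _).
by rewrite big_map -natr_sum -bin2_sum /index_iota subn0.
Qed.

(** Divisibility bounds the degree from below; the vanishing coefficients bound it from above and,
    for d = 3, exclude the value just under the upper bound. *)
Lemma size_mem_positions (d k m c : nat) (h : {poly F}) :
  (d == 2%N) || (d == 3%N) -> h != 0 ->
  (forall i, (i < d ^ 2)%N -> ('X - i%:R%:P) ^+ (m - c) %| h) ->
  (forall e, (k < d * c)%N || (d * (k - d * c) < e)%N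
     || [&& d == 3%N, (0 < k - d * c)%N & e == (d * (k - d * c)).-1] -> h`_e = 0) ->
  (size h).-1 \in positions d k m c.
Proof.
move=> hd h0 /dvdp_ptpoly hdiv hh.
have lc0 : h`_(size h).-1 != 0 by rewrite -/(lead_coef h) lead_coef_eq0.
have hkc : (d * c <= k)%N.
  by rewrite leqNgt; apply/negP => hk; rewrite hh ?hk ?eqxx in lc0.
have hhi : ((size h).-1 <= d * (k - d * c))%N.
  by rewrite leqNgt; apply/negP => hk; rewrite hh ?hk ?orbT ?eqxx in lc0.
have hlo : (d ^ 2 * (m - c) <= (size h).-1)%N.
   by have := dvdp_leq h0 hdiv; rewrite size_ptpoly; case: (size h).
rewrite /positions ltnNge hkc /=; case/orP: hd => /eqP dE.
  have -> : (d == 2%N) = true by rewrite dE.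
  rewrite mem_iota hlo /=.
  by rewrite subnKC ?ltnS // leqW // (leq_trans hlo).
have -> : (d == 2%N) = false by rewrite dE.
case: ltngtP => hk; first by have := leq_trans hlo hhi; rewrite leqNgt hk.
  rewrite in_cons mem_iota hlo /=; have [-> //|hne /=] := eqVneq (size h).-1 (d * (k - d * c))%N.
  suff : (size h).-1 != (d * (k - d * c)).-1.
    move: hk hlo hhi hne; move: (size h).-1 (d * (k - d * c))%N (d ^ 2 * (m - c))%N => s a b; clear; lia.
  apply/eqP => e; move: lc0; rewrite hh ?eqxx // e eqxx dE /= andbT.
  suff -> : (0 < k - 3 * c)%N by rewrite orbT.
  by move: hk; rewrite dE; case: (k - 3 * c)%N; rewrite ?muln0.
case: ifP => hcm; last by rewrite mem_seq1 eqn_leq hhi hk.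
(* The two bounds agree, so [h] is proportional to [ptpoly], whose second coefficient -36(m - c) is
   nonzero in characteristic 0, whereas [hh] makes that of [h] vanish. *)
have hp : h %= ptpoly (d ^ 2) (m - c).
  rewrite eqp_sym -dvdp_size_eqp // size_ptpoly eq_sym -[size h]prednK ?size_poly_gt0 //.
  by rewrite eqSS eqn_leq hlo -hk hhi.
have /eqpP[[a b] /= /andP[a0 b0] hab] := hp.
have := congr1 (fun p : {poly F} => p`_(d ^ 2 * (m - c)).-1) hab.
rewrite !coefZ coef_ptpoly; last by rewrite dE; lia.
rewrite hh ?mulr0; last first.
  by rewrite -hk dE /= eqxx andbT -dE; apply/orP; right; subst d; lia.
move/esym/eqP; rewrite mulf_eq0 (negPf b0) /= oppr_eq0 ((pcharf0P F).1 hF) dE muln_eq0 orbF; lia.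
Qed.

(** Strong induction on c: a nonzero f_c would have its degree among the positions, where its
    coefficient is zero. *)
Lemma comp_curve_eq0 (d k m : nat) (g : {poly {poly F}}) :
  (d == 2%N) || (d == 3%N) ->
  (forall i j, (k < i + j)%N -> g`_j`_i = 0) ->
  (forall i c, (i < d ^ 2)%N -> ('X - i%:R%:P) ^+ (m - c) %| (g \Po curve F d)`_c) ->
  (forall c e, e \in positions d k m c -> (g \Po curve F d)`_c`_e = 0) ->
  g = 0.
Proof.
move=> hd hg hdiv hpos; rewrite -[g](curve_compK d).
set f := g \Po curve F d; suff -> : f = 0 by rewrite comp_poly0.
suff h0 c : forall c', (c' < c)%N -> f`_c' = 0.
  by apply/polyP => c; rewrite (h0 c.+1) // coef0.
elim: c => // c IHc c'; rewrite ltnS leq_eqVlt => /orP[/eqP {c'}->|]; last exact: IHc.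
apply/eqP/negPn/negP => fc0.
suff /hpos/eqP : (size f`_c).-1 \in positions d k m c.
  by rewrite -/f -/(lead_coef _) lead_coef_eq0 (negPf fc0).
apply: size_mem_positions => // [i hi|e he]; first exact: hdiv.
(* Transported back to (x, y), this factorization writes [g] as u^c times a polynomial of total
   degree at most k - dc. *)
have fE : f = drop_poly c f * 'X^c.
  rewrite -{1}[f](poly_take_drop c) (_ : take_poly c f = 0) ?add0r //.
  apply/polyP => i; rewrite coef_take_poly coef0; case: ltnP => // /IHc; exact.
rewrite (_ : f`_c = (drop_poly c f)`_0); last by rewrite coef_drop_poly.
rewrite -[drop_poly c f](curve_compK d).
apply: (coef_comp_curve0_eq0 (k := k) (c := c)) he; first by case/orP: hd => /eqP ->.
apply: tdeg_curveXM => [|i j hij]; first by case/orP: hd => /eqP ->.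
rewrite mulrC (_ : _ * _ = g) ?hg //.
by rewrite -comp_Xn_poly -comp_polyM -fE curve_compK.
Qed.
End Points.

(** * Powers of linear forms in three variables *)

Definition x0 (R : nzRingType) : {mpoly R[3]} := 'X_(inord 0).
Definition x1 (R : nzRingType) : {mpoly R[3]} := 'X_(inord 1).
Definition x2 (R : nzRingType) : {mpoly R[3]} := 'X_(inord 2).

Lemma big_ord3 (V : nmodType) (E : 'I_3 -> V) :
  \sum_(i < 3) E i = E (inord 0) + (E (inord 1) + E (inord 2)).
Proof.
rewrite !big_ord_recl big_ord0 addr0; congr (E _ + (E _ + E _));
  by apply: val_inj; rewrite /= inordK.
Qed.

Lemma mdeg3 (mu : 'X_{1..3}) :
  mdeg mu = (mu (inord 0) + (mu (inord 1) + mu (inord 2)))%N.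
Proof. by rewrite mdegE big_ord3. Qed.

Lemma mnm3P (mu nu : 'X_{1..3}) :
  mdeg mu = mdeg nu -> mu (inord 0) = nu (inord 0) -> mu (inord 1) = nu (inord 1) -> mu = nu.
Proof.
rewrite !mdeg3 => e e0 e1; apply/mnmP => i.
have e2 : mu (inord 2) = nu (inord 2) by lia.
case: i => [[|[|[|//]]] hi].
- by rewrite (_ : Ordinal hi = inord 0) //; apply: val_inj; rewrite /= inordK.
- by rewrite (_ : Ordinal hi = inord 1) //; apply: val_inj; rewrite /= inordK.
- by rewrite (_ : Ordinal hi = inord 2) //; apply: val_inj; rewrite /= inordK.
Qed.

Definition lin3 (R : comNzRingType) (a b : R) : {mpoly R[3]} :=
  a *: x0 R + (b *: x1 R + x2 R).

(** The binomial theorem applied twice; the multiplier is the trinomial coefficient of [mu]. *)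
Lemma mcoeff_lin3X (R : comNzRingType) (a b : R) k (mu : 'X_{1..3}) :
  (lin3 a b ^+ k)@_mu =
  if mdeg mu == k
  then (a ^+ mu (inord 0) * b ^+ mu (inord 1)) *+
         ('C(k, mu (inord 0)) * 'C(k - mu (inord 0), mu (inord 1)))
  else 0.
Proof.
rewrite /lin3 exprDn linear_sum /=.
pose mon i j : 'X_{1..3} := ((U_(inord 0) *+ (k - i)) + ((U_(inord 1) *+ (i - j)) + (U_(inord 2) *+ j)))%MM.
have E (i : 'I_k.+1) : (((a *: x0 R) ^+ (k - i) * (b *: x1 R + x2 R) ^+ i) *+ 'C(k, i))@_mu
  = \sum_(j < i.+1) ((a ^+ (k - i) * b ^+ (i - j)) *+ ('C(k, i) * 'C(i, j))) * (mon i j == mu)%:R.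
  rewrite mcoeffMn exprDn mulr_sumr linear_sum /= -sumrMnl; apply: eq_bigr => j _.
    rewrite !exprZn [in LHS]mulrnAr mcoeffMn -mulrnA -scalerAl -scalerAl -scalerAr !mcoeffZ.
  rewrite /x0 /x1 /x2 !mpolyXn -!mpolyXD mcoeffX -/(mon i j) mulrA.
  by rewrite mulnC mulrnAl.
under eq_bigr do rewrite E.
have mon0 i j : mon i j (inord 0) = (k - i)%N.
  by rewrite !mnmDE !mulmnE !mnm1E -!val_eqE /= !inordK // ; lia.
have mon1 i j : mon i j (inord 1) = (i - j)%N.
  by rewrite !mnmDE !mulmnE !mnm1E -!val_eqE /= !inordK // ; lia.
have mon2 i j : mon i j (inord 2) = j.
  by rewrite !mnmDE !mulmnE !mnm1E -!val_eqE /= !inordK // ; lia.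
have mdm i j : (i <= k)%N -> (j <= i)%N -> mdeg (mon i j) = k.
  by move=> hi hj; rewrite mdeg3 mon0 mon1 mon2; lia.
case: eqP => [dk|ndk]; last first.
  rewrite big1 // => i _; rewrite big1 // => j _.
  case: eqP => [e|_]; last by rewrite mulr0.
  by case: ndk; rewrite -e mdm //; have := ltn_ord i; have := ltn_ord j; lia.
have := mdeg3 mu; rewrite dk => ek.
have hi : (k - mu (inord 0) < k.+1)%N by lia.
rewrite (bigD1 (Ordinal hi)) //= [X in _ + X]big1 ?addr0; last first.
  move=> i ne; rewrite big1 // => j _; case: eqP => [e|_]; last by rewrite mulr0.
  case/eqP: ne; apply: val_inj => /=; rewrite -e mon0; have := ltn_ord i; lia.
have hj : (mu (inord 2) < (k - mu (inord 0)).+1)%N by lia.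
rewrite (bigD1 (Ordinal hj)) //= [X in _ + X]big1 ?addr0; last first.
  move=> j ne; case: eqP => [e|_]; last by rewrite mulr0.
  by case/eqP: ne; apply: val_inj => /=; rewrite -[LHS](mon2 (k - mu (inord 0))%N) e.
have -> : mon (k - mu (inord 0))%N (mu (inord 2)) = mu.
  by apply: mnm3P; rewrite ?mdm ?mon0 ?mon1; lia.
rewrite eqxx mulr1; congr (_ ^+ _ * _ ^+ _ *+ (_ * _)); try lia.
  by rewrite bin_sub; lia.
rewrite -bin_sub; last by lia.
by congr 'C(_, _); lia.
Qed.

(** * The apolarity pairing *)

Section Pairing.
Variables (F : fieldType) (R : comNzRingType) (iota : {rmorphism F -> R}).
Variables (k : nat) (v : 'rV[F]_#|{: monos k}|).

(** The functional given by [v], with scalars extended to [R] so that it can be applied to powers of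
    linear forms with indeterminate coefficients. *)
Definition pairing (Q : {mpoly R[3]}) : R :=
  \sum_j Q@_(val (enum_val j)) * iota (v 0 j).

Lemma pairingD P Q : pairing (P + Q) = pairing P + pairing Q.
Proof. by rewrite -big_split; apply: eq_bigr => j _; rewrite mcoeffD mulrDl. Qed.

Lemma pairing0 : pairing 0 = 0.
Proof. by rewrite /pairing big1 // => j _; rewrite mcoeff0 mul0r. Qed.

Lemma pairing_sum (I : Type) (s : seq I) (P : pred I) (E : I -> {mpoly R[3]}) :
  pairing (\sum_(i <- s | P i) E i) = \sum_(i <- s | P i) pairing (E i).
Proof. exact: (big_morph _ pairingD pairing0). Qed.

Lemma pairingZ c Q : pairing (c *: Q) = c * pairing Q.
Proof. by rewrite /pairing mulr_sumr; apply: eq_bigr => j _; rewrite mcoeffZ mulrA. Qed.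

Lemma pairingMn Q n : pairing (Q *+ n) = pairing Q *+ n.
Proof. by rewrite /pairing -sumrMnl; apply: eq_bigr => j _; rewrite mcoeffMn mulrnAl. Qed.

(** The hypothesis on [v] is the case where [Q] is a monomial; linearity over [R] gives the rest. *)
Lemma pairing_genmx l r (p : 'I_l -> 'rV[F]_3) i Q :
  (r <= k)%N -> v *m (Defs.genmx r k p)^T = 0 -> Q \is (k - r)%N.-homog ->
  pairing (Q * map_mpoly iota (linform (p i)) ^+ r) = 0.
Proof.
move=> rk hv hQ; rewrite [Q]mpolyE mulr_suml pairing_sum big_seq big1 // => mu hmu.
rewrite -scalerAl pairingZ (_ : pairing _ = 0) ?mulr0 //.
have dmu := dhomog_mf hQ hmu; rewrite /= in dmu.
have bmu : (mdeg mu < (k - r).+1)%N by rewrite dmu.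
have := congr1 (fun M : 'rV_ _ => iota (M 0 (enum_rank (i, BMultinom bmu)))) hv.
rewrite !mxE rmorph0 rmorph_sum => e; rewrite -[RHS]e; apply: eq_bigr => j _.
rewrite !mxE enum_rankK /= dmu eqxx rmorphM mulrC; congr (_ * _).
by rewrite /coefrow mxE -rmorphXn /= -(map_mpolyX iota) -rmorphM mcoeff_map_mpoly.
Qed.

(* The terms of the binomial expansion divisible by p_i^r are killed, so only
   terms of order at least k - r + 1 in (a, b) survive. *)
Lemma pairing_osculating l r (p : 'I_l -> 'rV[F]_3) i (a b : R) (A B : {mpoly R[3]}) :
  (r <= k)%N -> v *m (Defs.genmx r k p)^T = 0 ->
  A \is 1.-homog -> B \is 1.-homog ->
  exists q : nat -> R,
  pairing ((map_mpoly iota (linform (p i)) + (a *: A + b *: B)) ^+ k) =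
    \sum_(s < (k - r).+2) a ^+ ((k - r).+1 - s) * b ^+ s * q s.
Proof.
move=> rk hv hA hB; set L := map_mpoly _ _; set W := a *: A + b *: B.
have hW : W \is 1.-homog by rewrite rpredD // rpredZ.
have hL : L \is 1.-homog.
  rewrite /L /linform raddf_sum /= rpred_sum // => j _.
  by rewrite map_mpolyZ rpredZ // map_mpolyX dhomogX /= mdeg1.
rewrite exprDn pairing_sum.
set m := (k - r).+1.
suff H (j : 'I_k.+1) : exists q : nat -> R, pairing (L ^+ (k - j) * W ^+ j *+ 'C(k, j)) =
    \sum_(s < m.+1) a ^+ (m - s) * b ^+ s * q s.
  elim: (index_enum _) => [|j s [q IHs]].
    exists (fun=> 0); rewrite big_nil big1 // => s _; exact: mulr0.
  have [q' hq'] := H j; exists (fun s => q' s + q s).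
  rewrite big_cons IHs hq' -big_split; apply: eq_bigr => i' _; by rewrite mulrDr.
have [hj|hj] := leqP j (k - r).
  exists (fun=> 0); rewrite [RHS]big1 => [|s _]; last exact: mulr0.
  have -> : (k - j = (k - r - j) + r)%N by lia.
  rewrite pairingMn exprD mulrAC pairing_genmx ?mul0rn //.
  by have := dhomogM (dhomogMn (k - r - j) hL) (dhomogMn j hW); rewrite !mul1n subnK.
(* Since j >= m, one factor W^m of W^j is expanded in a and b; the remaining W^(j - m) stays inside
   the pairing. *)
exists (fun s => pairing (A ^+ (m - s) * B ^+ s * W ^+ (j - m) * L ^+ (k - j)) *+ 'C(m, s) *+ 'C(k, j)).
rewrite [W ^+ j](_ : _ = W ^+ m * W ^+ (j - m)); last by rewrite -exprD subnKC.
rewrite pairingMn mulrC {1}/W (exprDn (a *: A)) !mulr_suml pairing_sum -sumrMnl.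
apply: eq_bigr => s _.
rewrite !mulrnAl pairingMn !mulrnAr; congr (_ *+ _ *+ _).
by rewrite !exprZn -scalerAl -scalerAr scalerA -!scalerAl pairingZ.
Qed.
End Pairing.

(** * The form dual to a functional, for points on the curve *)

Lemma map_lin3 (R S : comNzRingType) (f : {rmorphism R -> S}) a b :
  map_mpoly f (lin3 a b) = lin3 (f a) (f b).
Proof. by rewrite /lin3 !rmorphD /= !map_mpolyZ /x0 /x1 /x2 !map_mpolyX. Qed.

Definition curve_pt (F : fieldType) (d : nat) (t : F) : 'rV[F]_3 :=
  \row_(j < 3) [:: t; t ^+ d; 1]`_j.

Lemma linform_curve_pt (F : fieldType) (d : nat) (t : F) :
  linform (curve_pt d t) = lin3 t (t ^+ d).
Proof. by rewrite /linform big_ord3 !mxE !inordK // scale1r. Qed.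

Lemma curve_pt_neq0 (F : fieldType) (d : nat) (t : F) : curve_pt d t != 0.
Proof.
apply/eqP => /matrixP/(_ 0 (inord 2)); rewrite !mxE inordK //= => /eqP.
by rewrite oner_eq0.
Qed.

Section Nullforms.
Variables (F : fieldType).
Hypothesis hF : [pchar F] =i pred0.
Variables (d k r l : nat).
Hypothesis hd : (d == 2%N) || (d == 3%N).
Hypothesis hrk : (r <= k)%N.
Hypothesis hl : l = (d ^ 2)%N.

Let R : comNzRingType := {poly {poly F}}.
Let cst : {rmorphism F -> R} := (polyC \o polyC).
Let pts (i : 'I_l) := curve_pt d (i%:R : F).
Let m := (k - r).+1.

Variable v : 'rV[F]_#|{: monos k}|.

(** Up to trinomial factors, [g] is the dehomogenized form of degree k dual to [v]; [f] is the same
    form in the coordinates (x, u). *)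
Let f : R := pairing cst v (lin3 ('X%:P : R) (curve F d) ^+ k).
Let g : R := pairing cst v (lin3 ('X%:P : R) 'X ^+ k).

Lemma restriction_comp : f = g \Po curve F d.
Proof.
rewrite /f /g /pairing (raddf_sum (comp_poly (curve F d))) /=; apply: eq_bigr => j _.
rewrite comp_polyM comp_polyC; congr (_ * _).
rewrite !mcoeff_lin3X; case: ifP => _; last by rewrite comp_poly0.
by rewrite raddfMn /= comp_polyM !rmorphXn /= comp_polyC comp_polyX.
Qed.

Lemma coef_restriction i j :
  g`_j`_i = \sum_(n < #|{: monos k}|)
    (let mu := val (enum_val n) in
     if [&& mdeg mu == k, mu (inord 0) == i & mu (inord 1) == j]
     then v 0 n *+ ('C(k, mu (inord 0)) * 'C(k - mu (inord 0), mu (inord 1))) else 0).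
Proof.
rewrite /g /pairing !coef_sum; apply: eq_bigr => n _.
rewrite /= !coefMC mcoeff_lin3X; case: ifP => _; last by rewrite !coef0 mul0r.
rewrite !coefMn -rmorphXn /= coefCM coefXn.
rewrite mulr_natr coefMn coefXn ![_ == i]eq_sym ![_ == j]eq_sym /=.
by case: eqP => _; case: eqP => _; rewrite /= ?mulr0n ?mul0rn ?mul0r // mulr1n mulr_natl.
Qed.

Lemma coef_restriction_eq0 i j : (k < i + j)%N -> g`_j`_i = 0.
Proof.
move=> hk; rewrite coef_restriction big1 // => n _ /=.
by case: ifP => // /and3P[/eqP e /eqP e0 /eqP e1]; move: e; rewrite mdeg3; lia.
Qed.

(** Each degree-k coordinate of [v] occurs in [g] times a trinomial coefficient, which is nonzero in
    characteristic 0. *)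
Lemma restriction_inj n : mdeg (val (enum_val n)) = k -> g = 0 -> v 0 n = 0.
Proof.
set mu := val (enum_val n) => hmu g0.
have := coef_restriction (mu (inord 0)) (mu (inord 1)).
rewrite g0 !coef0 (bigD1 n) //= -/mu hmu !eqxx /= big1 ?addr0 => [/esym/eqP|n' ne]; last first.
  case: ifP => // /and3P[/eqP e /eqP e0 /eqP e1]; case/eqP: ne.
  by apply/enum_val_inj/val_inj/mnm3P; rewrite // e.
have hk := mdeg3 mu; rewrite hmu in hk.
rewrite -mulr_natr mulf_eq0 ((pcharf0P F).1 hF) muln_eq0 => /orP[/eqP //|].
by rewrite !eqn0Ngt !bin_gt0; lia.
Qed.

(** Expanding around the point t in a = x - t and b = u leaves only terms of order m; those
    contributing to u^c carry at most c factors b, hence at least m - c factors a. *)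
Lemma pairing_curve_dvd i c : (i < d ^ 2)%N ->
  v *m (Defs.genmx r k pts)^T = 0 -> ('X - i%:R%:P) ^+ (m - c) %| f`_c.
Proof.
rewrite -hl => hi hv.
pose t : F := i%:R.
(* [gam] is (x^d - t^d)/(x - t), so the linear form at (x, x^d - u) is the one at t plus (x - t)(x0
   + gam x1) - u x1. *)
pose gam : {poly F} := \sum_(j < d) 'X^(d.-1 - j) * (t%:P) ^+ j.
have hA : x0 R + gam%:P *: x1 R \is 1.-homog.
  by rewrite rpredD // ?rpredZ // /x0 /x1 dhomogX /= mdeg1.
have hB : - x1 R \is 1.-homog by rewrite rpredN /x1 dhomogX /= mdeg1.
have [q] := @pairing_osculating F R cst k v l r pts (Ordinal hi) ('X - t%:P)%:P 'X _ _ hrk hv hA hB.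
rewrite /pts linform_curve_pt map_lin3.
rewrite (_ : _ + _ = lin3 ('X%:P : R) (curve F d)) => [fE|].
  rewrite -/f in fE; rewrite fE coef_sum.
  apply: (big_ind (fun h => _ %| h)) => [||s _]; [exact: dvdp0|exact: dvdp_add|].
  rewrite mulrAC -mulrA -rmorphXn /= coefCM mulrC.
  rewrite coefMXn.
  case: ltnP => hs; first by rewrite mul0r dvdp0.
  by apply: dvdp_mull; apply: dvdp_exp2l; lia.
rewrite /lin3 /curve scalerDr scalerA -rmorphM /= scalerN.
have -> : ('X - t%:P) * gam = 'X^d - (t ^+ d)%:P.
  by rewrite rmorphXn /= /gam subrXX; congr (_ * _).
rewrite /= !polyCB !scalerBl.
move: (_ *: x0 R) (_ *: x0 R) (_ *: x1 R) (_ *: x1 R) (_ *: x1 R) (x2 R).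
by move=> a b c1 c2 c3 e; ring.
Qed.

Definition test_seq : seq (nat * nat) :=
  flatten [seq [seq (c, e) | e <- positions d k m c] | c <- iota 0 k.+1].

Lemma size_test_seq : (size test_seq <= 'C(k.+2, 2) - l * 'C(m.+1, 2))%N.
Proof.
rewrite size_flatten /shape -map_comp sumnE big_map hl.
rewrite -[iota 0 k.+1]/(index_iota 0 k.+1) big_mkord.
by under eq_bigr do rewrite /= size_map; apply: sum_size_positions.
Qed.

Lemma mem_test_seq c e : e \in positions d k m c -> (c, e) \in test_seq.
Proof.
move=> he; apply/flattenP; exists [seq (c, e') | e' <- positions d k m c].
  apply/mapP; exists c => //; rewrite mem_iota add0n ltnS leqNgt.
  apply/negP => hc; move: he; rewrite positions_out //.
  by case/orP: hd => /eqP ->; lia.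
by apply/mapP; exists e.
Qed.

(** The product of [v] with the column of (c, e) is the coefficient of x^e u^c in [f]. *)
Definition test_mx : 'M[F]_(#|{: monos k}|, size test_seq) :=
  \matrix_(n, a) (let ce := nth (0, 0)%N test_seq a in
    ((lin3 ('X%:P : R) (curve F d) ^+ k)@_(val (enum_val n)))`_ce.1`_ce.2).

Lemma nullform_eq0 n :
  v *m (Defs.genmx r k pts)^T = 0 -> v *m test_mx = 0 ->
  mdeg (val (enum_val n)) = k -> v 0 n = 0.
Proof.
move=> hv ht hn; apply: restriction_inj => //.
apply: (@comp_curve_eq0 F hF d k m) => // [i j|i c hi|c e he].
- exact: coef_restriction_eq0.
- by rewrite -restriction_comp; apply: pairing_curve_dvd.
rewrite -restriction_comp.
have hs : (index (c, e) test_seq < size test_seq)%N by rewrite index_mem mem_test_seq.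
have := congr1 (fun M : 'rV_ _ => M 0 (Ordinal hs)) ht.
rewrite !mxE => h0; rewrite -[RHS]h0 /f /pairing !coef_sum; apply: eq_bigr => j _.
by rewrite mxE /= nth_index ?mem_test_seq //= !coefMC mulrC.
Qed.
End Nullforms.

(** * Rank estimates and the minimum *)

Lemma dimSkE k : dimSk k = 'C(k.+2, 2).
Proof.
rewrite -[k.+2]addn2 -bin_sub ?leq_addl // addnK -(size_basis 2 k) /dimSk cardE.
rewrite -(size_map val); apply/perm_size/uniq_perm.
- by rewrite map_inj_uniq ?enum_uniq //; apply: val_inj.
- exact: uniq_basis.
move=> mu; rewrite -basis_cover; apply/mapP/idP => [[nu] | hmu].
  by rewrite mem_enum inE => hnu ->.
have hk : (mdeg mu < k.+1)%N by rewrite (eqP hmu).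
by exists (BMultinom hk); rewrite ?mem_enum ?inE.
Qed.

Lemma mxrank_row_mx (F : fieldType) n p q (A : 'M[F]_(n, p)) (B : 'M_(n, q)) :
  (\rank (row_mx A B) <= \rank A + \rank B)%N.
Proof.
rewrite -mxrank_tr tr_row_mx -(mxrank_tr A) -(mxrank_tr B) -addsmxE.
exact: mxrank_adds_leqif.
Qed.

(** The columns of A^T, [B] and [E] together have trivial left kernel, so their ranks add up to at
    least the number of monomials; [B] has as many columns as there are test coefficients. *)
Lemma corank_curve_pts (F : fieldType) (hF : [pchar F] =i pred0) (d k r l : nat) :
  (d == 2%N) || (d == 3%N) -> (r <= k)%N -> l = (d ^ 2)%N ->
  (dimSk k - \rank (Defs.genmx r k (fun i : 'I_l => curve_pt d (i%:R : F)))
    <= 'C(k.+2, 2) - l * 'C((k - r).+2, 2))%N.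
Proof.
move=> hd hrk hl; set A := Defs.genmx _ _ _.
apply: leq_trans (size_test_seq k r hd hl).
set B := test_mx F d k r.
pose D := [set mu : monos k | mdeg (val mu) == k].
(* [monos k] also contains the monomials of degree below k; [E] has one column to kill each of those
   coordinates. *)
pose E : 'M[F]_(#|{: monos k}|, #|~: D|) :=
  \matrix_(n, a) (enum_val n == enum_val a)%:R.
have : row_free (row_mx (row_mx A^T B) E).
  rewrite -kermx_eq0; apply/eqP/row_matrixP => i; rewrite row0.
  have := row_mul i (kermx (row_mx (row_mx A^T B) E)) (row_mx (row_mx A^T B) E).
  rewrite mulmx_ker row0; move: (row i _) => v /esym.
  rewrite !mul_mx_row -[0]row_mx0 => /eq_row_mx[]; rewrite -[0]row_mx0 => /eq_row_mx[hA hB] hE.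
  apply/rowP => n; rewrite [RHS]mxE.
  have [hn|hn] := boolP (enum_val n \in D).
    by apply: (nullform_eq0 hF hd hrk hl hA hB); rewrite inE in hn; apply/eqP.
  have hn' : enum_val n \in ~: D by rewrite inE.
  have := congr1 (fun M : 'rV_ _ => M 0 (enum_rank_in hn' (enum_val n))) hE.
  rewrite !mxE (bigD1 n) //= big1 => [|n' ne].
    by rewrite mxE enum_rankK_in // eqxx mulr1 addr0.
  rewrite mxE enum_rankK_in // (inj_eq enum_val_inj) (negPf ne); exact: mulr0.
move=> /eqP hr; rewrite /dimSk leq_subLR -(leq_add2r #|~: D|) -/D cardsC -[X in (X <= _)%N]hr.
apply: leq_trans (mxrank_row_mx _ _) (leq_add _ (rank_leq_col E)).
rewrite -[\rank A]mxrank_tr.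
exact: leq_trans (mxrank_row_mx _ _) (leq_add (leqnn _) (rank_leq_col B)).
Qed.

(** The rows outside [D] are zero, so the matrix factors through the rows in [D]. *)
Lemma rank_genmx (F : fieldType) (l r k : nat) (p : 'I_l -> 'rV[F]_3) :
  (\rank (Defs.genmx r k p) <= l * 'C((k - r).+2, 2))%N.
Proof.
set A := Defs.genmx r k p.
pose D := [set im : 'I_l * monos (k - r) | mdeg (val im.2) == (k - r)%N].
have hD : #|D| = (l * 'C((k - r).+2, 2))%N.
  rewrite -dimSkE /dimSk -[l in RHS]card_ord -cardsT -cardsX; apply: eq_card => im.
  by rewrite !inE.
rewrite -hD.
pose E : 'M[F]_(#|{: 'I_l * monos (k - r)}|, #|D|) :=
  \matrix_(a, b) (enum_val a == enum_val b)%:R.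
pose B : 'M[F]_(#|D|, #|{: monos k}|) :=
  \matrix_(b, j) A (enum_rank (enum_val b)) j.
suff -> : A = E *m B by apply: mulmx_max_rank.
apply/matrixP => a j; rewrite [RHS]mxE.
have [ha|ha] := boolP (enum_val a \in D).
  rewrite (bigD1 (enum_rank_in ha (enum_val a))) //= big1 => [|b ne].
    by rewrite [E _ _]mxE [B _ _]mxE !enum_rankK_in // eqxx mul1r addr0 enum_valK.
  rewrite [E _ _]mxE; case: eqP => [e|_]; last by rewrite mul0r.
  by case/eqP: ne; apply: enum_val_inj; rewrite enum_rankK_in.
rewrite big1 => [|b _]; last first.
  rewrite [E _ _]mxE; case: eqP => [e|_]; last by rewrite mul0r.
  by move: ha; rewrite e enum_valP.
by move: ha; rewrite inE /A mxE /= => /negPf ->.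
Qed.

(** Counting generators gives the lower bound for all points, and the points on the curve attain
    it. *)
Lemma is_hmin_square (F : fieldType) (hF : [pchar F] =i pred0) (d k r l : nat) :
  (d == 2%N) || (d == 3%N) -> l = (d ^ 2)%N ->
  is_hmin F l r k (if (k < r)%N then 'C(k.+2, 2) else 'C(k.+2, 2) - l * 'C((k - r).+2, 2))%N.
Proof.
move=> hd hl; split; last first.
  move=> p hp; rewrite /hpts dimSkE; case: ifP => // _.
  exact/leq_sub2l/rank_genmx.
exists (fun i => curve_pt d i%:R); split; first by move=> i; apply: curve_pt_neq0.
rewrite /hpts; case: ltnP => [_|hrk]; first exact: dimSkE.
apply/eqP; rewrite eqn_leq corank_curve_pts //= dimSkE.
exact/leq_sub2l/rank_genmx.
Qed.

Theorem mainTheorem11 (F : closedFieldType) (hF : [pchar F] =i pred0)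
  (l : nat) (hl : l = 4%N \/ l = 9%N) :
  forall (r : int) (k : nat), is_h F l r k (cval l r k).
Proof.
have [d hd ld] : exists2 d : nat, (d == 2%N) || (d == 3%N) & l = (d ^ 2)%N.
  by case: hl => ->; [exists 2%N | exists 3%N].
move=> [r|r] k; rewrite /is_h /cval /=.
  rewrite lez_nat leqNgt.
  have := is_hmin_square hF k r hd ld; case: ltnP => //= hrk.
  by rewrite subzn.
(* For r < 0, h is 0 by convention, and c truncates to 0 because k - r > k and l >= 1. *)
have l0 : (0 < l)%N by case: hl => ->.
apply/eqP; rewrite subn_eq0.
by rewrite (leq_trans _ (leq_pmull _ l0)) // leq_bin2l //; lia.
Qed.
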